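(* Let $\mu_0$ and $\pi$ be probability distributions on $\mathbb{R}^d$ with densities with respect to Lebesgue measure (denoted by the same letters), let $T\ge 1$, and let $0=\lambda_0<\lambda_1<\dots<\lambda_T=1$. Let $(\mu_n)_{n=1}^T$ be the tempering sequence $$\mu_{n}\propto \mu_0^{1-\lambda_{n}}\,\pi^{\lambda_{n}},\qquad 1\le n\le T .$$ Given real numbers $\gamma_1,\dots,\gamma_T$, let $(\nu_n)_{n=0}^T$ be the entropic mirror descent iterates on the functional $\mu\mapsto\mathrm{KL}(\mu|\pi)$ with step-sizes $\gamma_n$ started at $\nu_0=\mu_0$: $$\nu_{n+1}\propto \nu_n^{1-\gamma_{n+1}}\,\pi^{\gamma_{n+1}},\qquad 0\le n< T .$$ (i) If $\lambda_n = 1-\prod_{k=1}^n(1-\gamma_k)$ for all $1\le n\le T$, then $\nu_n=\mu_n$ for all $1\le n\le T$, and $\gamma_1=\lambda_1$, $\gamma_n=\dfrac{\lambda_n-\lambda_{n-1}}{1-\lambda_{n-1}}$ for $1\le n<T$, and $\gamma_T=\lambda_T=1$. (ii) Conversely, if $\gamma_n$ is defined by $\gamma_n=\dfrac{\lambda_n-\lambda_{n-1}}{1-\lambda_{n-1}}$, then $\gamma_n<1$ whenever $\lambda_n\in(0,1)$, and for such $n$ one has $\mathrm{KL}(\mu_n|\pi)\le \mathrm{KL}(\mu_{n-1}|\pi)$.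
   Context: For probability measures $\nu,\mu$ on $\mathbb{R}^d$, $\mathrm{KL}(\nu|\mu)=\int\log\left(\frac{d\nu}{d\mu}\right)d\nu$ if $\nu$ is absolutely continuous with respect to $\mu$, and $+\infty$ otherwise. The symbol $\propto$ means equality up to the positive normalizing constant making the left-hand side a probability density; it is assumed that these normalizing constants are positive, so that all sequences are well defined. The convention $0^0=1$ is used (so exponents $\lambda_T=1$, $\gamma_T=1$ give $\pi$). *)

(* Defs.v *)
From HB Require Import structures.
From mathcomp Require Import all_boot all_order all_algebra.
From mathcomp Require Import all_classical all_reals all_analysis.

Set Implicit Arguments.
Unset Strict Implicit.
Unset Printing Implicit Defensive.

Import Order.TTheory GRing.Theory Num.Theory.
Import numFieldNormedType.Exports.
Local Open Scope classical_set_scope.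
Local Open Scope ring_scope.

(* The sigma-algebra of tuples generated by the coordinates is the Borel
   sigma-algebra of R^d. *)
Notation Rd R d := (d.-tuple (measurableTypeR R)).

Section lebesgue_cons.
Context {R : realType} {d : nat}.
Variable m : {sigma_finite_measure set (Rd R d) -> \bar R}.
Local Open Scope ereal_scope.

Let cons_pair (z : measurableTypeR R * Rd R d) : Rd R d.+1 :=
  [the d.+1.-tuple (measurableTypeR R) of z.1 :: z.2].

Let measurable_cons_pair : measurable_fun [set: _] cons_pair.
Proof. by apply: measurable_cons. Qed.

Definition lebesgue_cons : set (Rd R d.+1) -> \bar R :=
  pushforward (@lebesgue_measure R \x m) cons_pair.

Let lebesgue_cons0 : lebesgue_cons set0 = 0.
Proof. by rewrite /lebesgue_cons /pushforward preimage_set0 measure0. Qed.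

Let lebesgue_cons_ge0 A : 0 <= lebesgue_cons A.
Proof. exact: measure_ge0. Qed.

Let lebesgue_cons_sigma_additive : semi_sigma_additive lebesgue_cons.
Proof.
move=> F mF tF mUF; rewrite /lebesgue_cons /pushforward preimage_bigcup.
apply: measure_semi_sigma_additive.
- by move=> n; rewrite -[X in measurable X]setTI; exact: measurable_cons_pair.
- apply/trivIsetP => /= i j _ _ ij; rewrite -preimage_setI.
  by move/trivIsetP : tF => /(_ _ _ _ _ ij) ->//; rewrite preimage_set0.
- by rewrite -preimage_bigcup -[X in measurable X]setTI;
    exact: measurable_cons_pair.
Qed.

HB.instance Definition _ := isMeasure.Build _ _ _ lebesgue_cons
  lebesgue_cons0 lebesgue_cons_ge0 lebesgue_cons_sigma_additive.

Let lebesgue_cons_sigma_finite : sigma_finite [set: Rd R d.+1] lebesgue_cons.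
Proof.
have /sigma_finiteP[F [TF ndF Foo]] := sigma_finiteT (@lebesgue_measure R).
have /sigma_finiteP[G [TG ndG Goo]] := sigma_finiteT m.
pose uncons (t : Rd R d.+1) : measurableTypeR R * Rd R d :=
  (tnth t ord0, [tuple of behead t]).
have munc : measurable_fun [set: _] uncons.
  by apply: measurable_fun_pair; [exact: measurable_tnth|exact: measurable_behead].
have consK : cancel cons_pair uncons.
  by move=> [x t]; rewrite /uncons /cons_pair /=; congr pair; exact/val_inj.
exists (fun i => uncons @^-1` (F i `*` G i)).
  rewrite -preimage_bigcup (_ : \bigcup_i (F i `*` G i) = setT) ?preimage_setT//.
  rewrite -subTset => -[x y] _ /=.
  have : [set: measurableTypeR R] x by [].
  have : [set: Rd R d] y by [].
  rewrite TF TG => -[k _ Gky] [n _ Fnx]; exists (maxn n k) => //; split.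
  - by move: x Fnx; exact/subsetPset/ndF/leq_maxl.
  - by move: y Gky; exact/subsetPset/ndG/leq_maxr.
move=> i; have [mF Fi] := Foo i; have [mG Gi] := Goo i; split.
  by rewrite -[X in measurable X]setTI; apply: munc => //; exact: measurableX.
rewrite /lebesgue_cons /pushforward -comp_preimage.
rewrite (_ : uncons \o cons_pair = id) ?preimage_id; last exact/funext.
by rewrite product_measure1E// lte_mul_pinfty// ge0_fin_numE.
Qed.

HB.instance Definition _ := Measure_isSigmaFinite.Build _ _ _ lebesgue_cons
  lebesgue_cons_sigma_finite.

End lebesgue_cons.

(* Lebesgue measure on R^d, the d-fold product of the one-dimensional one. *)
Fixpoint lebesgueRd (R : realType) (d : nat) :
    {sigma_finite_measure set (Rd R d) -> \bar R} :=
  match d with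
  | 0 => \d_([tuple] : Rd R 0)
  | d'.+1 => lebesgue_cons (lebesgueRd R d')
  end.

(* For probability measures the negative part of log (dnu/dmu) is
   nu-integrable, so the integral below is never of the form +oo - oo. *)
Definition KL {disp : measure_display} {X : measurableType disp} {R : realType}
    (nu mu : probability X R) : \bar R :=
  if `[< nu `<< mu >] then
    (\int[nu]_x lne (Radon_Nikodym (charge_of_finite_measure nu) mu x))%E
  else +oo%E.

Section sequences.
Context {R : realType} {d : nat}.
Local Notation X := (Rd R d).
Implicit Types (rho mu nu pi : probability X R) (f g h : X -> R).

Definition has_density rho f : Prop :=
  [/\ measurable_fun setT f, (forall x, 0 <= f x) &
    forall A, measurable A ->
      rho A = (\int[lebesgueRd R d]_(x in A) (f x)%:E)%E].

Definition propto rho h : Prop :=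
  exists2 c : R, 0 < c & has_density rho (fun x => c * h x).

(* The choice of the densities is immaterial, as two
   densities of the same measure agree almost everywhere. The convention
   0^0 = 1 is the one of powR. *)
Definition propto_geometric rho mu a pi b : Prop :=
  exists f g, [/\ has_density mu f, has_density pi g &
    propto rho (fun x => f x `^ a * g x `^ b)].

Definition tempering_sequence (T : nat) (lambda : nat -> R) mu0 pi
    (mu : nat -> probability X R) : Prop :=
  mu 0%N = mu0 /\
  forall n, (1 <= n <= T)%N ->
    propto_geometric (mu n) mu0 (1 - lambda n) pi (lambda n).

Definition mirror_descent_sequence (T : nat) (gamma : nat -> R) mu0 pi
    (nu : nat -> probability X R) : Prop :=
  nu 0%N = mu0 /\
  forall n, (n < T)%N ->
    propto_geometric (nu n.+1) (nu n) (1 - gamma n.+1) pi (gamma n.+1).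

End sequences.

(* Main.v *)
Require Import Defs.
From HB Require Import structures.
From mathcomp Require Import all_boot all_order all_algebra.
From mathcomp Require Import all_classical all_reals all_analysis.
From mathcomp Require Import ring lra.
From mathcomp Require Import measurable_realfun.

(** The tempering sequence is itself multiplicative: mu_{n+1} is proportional to
    mu_n^{1-t} pi^t with t = (lambda_{n+1} - lambda_n) / (1 - lambda_n), and
    densities are unique almost everywhere, so (i) follows by induction on n.
    For (ii), put q = dmu_n/dpi and s = 1 - t in (0, 1). Then
    p = dmu_{n+1}/dpi is c q^s, and log x <= x - 1 applied to q / p and to p / q
    gives KL(mu_{n+1}|pi) <= log c / (1 - s) <= KL(mu_n|pi). *)

Import Order.TTheory GRing.Theory Num.Theory.
Import numFieldNormedType.Exports.
Local Open Scope classical_set_scope.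
Local Open Scope ring_scope.
Set Implicit Arguments.
Unset Strict Implicit.
Unset Printing Implicit Defensive.

(** The reference measure is left arbitrary because densities are taken both with respect to
    Lebesgue measure, where this unfolds to [has_density], and with respect to [pi]. *)
Definition is_density {disp : measure_display} {X : measurableType disp}
    {R : realType} (m : {measure set X -> \bar R}) (nu : set X -> \bar R)
    (f : X -> R) : Prop :=
  [/\ measurable_fun setT f, (forall x, 0 <= f x) &
    forall A, measurable A -> nu A = (\int[m]_(x in A) (f x)%:E)%E].

(** * Densities and change of reference measure *)

Section density_lemmas.
Context {disp : measure_display} {X : measurableType disp} {R : realType}.
Implicit Types (m : {sigma_finite_measure set X -> \bar R}).
Implicit Types (nu pi : probability X R) (f g : X -> R).

(** Positive and negative parts are compared separately, so neither side has to be integrable; this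
    matters for logarithms of densities, whose integral may be infinite. *)
Lemma le_integral_ae (mu : {measure set X -> \bar R}) (u v : X -> \bar R) :
  measurable_fun setT u -> measurable_fun setT v ->
  {ae mu, forall x, (u x <= v x)%E} ->
  (\int[mu]_x u x <= \int[mu]_x v x)%E.
Proof.
move=> mfu mfv uv; rewrite integralE [leRHS]integralE; apply: leeB.
- apply: ae_ge0_le_integral => //; do ?exact: measurable_funepos.
  by apply: filterS uv => x uvx _; rewrite !funeposE ge_max le_max uvx le_max lexx orbT.
- apply: ae_ge0_le_integral => //; do ?exact: measurable_funeneg.
  apply: filterS uv => x uvx _.
  by rewrite !funenegE ge_max le_max leeN2 uvx le_max lexx orbT.
Qed.

Lemma is_density_dominates m nu f : is_density m nu f -> nu `<< m.
Proof.
move=> [mf f0 nuE]; apply/null_content_dominatesP => A mA mA0.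
rewrite nuE//; apply: null_set_integral => //.
by apply/measurable_EFinP; exact: measurable_funTS.
Qed.

Lemma is_density_integrable m nu f : is_density m nu f ->
  m.-integrable setT (EFin \o f).
Proof.
move=> [mf f0 nuE]; apply/integrableP; split; first exact/measurable_EFinP.
under eq_integral => x _ do rewrite /= ger0_norm//.
by rewrite -nuE// probability_setT ltry.
Qed.

Lemma is_density_unique m nu f g : is_density m nu f -> is_density m nu g ->
  {ae m, forall x, f x = g x}.
Proof.
move=> df dg; have [mg _ gE] := dg; have [_ _ fE] := df.
have : ae_eq m setT (EFin \o f) (EFin \o g).
  apply: integral_ae_eq => //.
  - exact: is_density_integrable df.
  - exact/measurable_EFinP.
  - by move=> A _ mA /=; rewrite -fE// -gE.
by apply: filterS => x /(_ I)[].
Qed.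

Lemma is_density_ae m nu f g : is_density m nu f ->
  measurable_fun setT g -> (forall x, 0 <= g x) ->
  {ae m, forall x, f x = g x} -> is_density m nu g.
Proof.
move=> [mf f0 fE] mg g0 fg; split => // A mA; rewrite fE//.
apply: ge0_ae_eq_integral => //.
- by apply/measurable_EFinP; exact: measurable_funTS.
- by apply/measurable_EFinP; exact: measurable_funTS.
- by move=> x _; rewrite lee_fin.
- by move=> x _; rewrite lee_fin.
- by apply: filterS fg => x -> _.
Qed.

(** The change of variables is known for the Radon-Nikodym derivative, and [f] agrees with it
    [m]-almost everywhere since both have the same integral over every measurable set. *)
Lemma ge0_integral_density m nu f (h : X -> \bar R) A : is_density m nu f ->
  measurable A -> measurable_fun setT h -> (forall x, (0 <= h x)%E) ->
  (\int[nu]_(x in A) h x = \int[m]_(x in A) (h x * (f x)%:E))%E.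
Proof.
move=> df mA mh h0; have num := is_density_dominates df.
have [mf f0 fE] := df.
rewrite -(Radon_Nikodym_SigmaFinite.change_of_variables num)//; last first.
  exact: measurable_funTS.
have mr : measurable_fun setT (Radon_Nikodym_SigmaFinite.f nu m).
  exact: measurable_int (Radon_Nikodym_SigmaFinite.f_integrable num).
apply: ge0_ae_eq_integral => //.
- by apply: emeasurable_funM; exact: measurable_funTS.
- apply: emeasurable_funM; first exact: measurable_funTS.
  by apply/measurable_EFinP; exact: measurable_funTS.
- by move=> x _; apply: mule_ge0 => //; exact: Radon_Nikodym_SigmaFinite.f_ge0.
- by move=> x _; apply: mule_ge0; rewrite // lee_fin.
- have : ae_eq m setT (Radon_Nikodym_SigmaFinite.f nu m) (EFin \o f).
    apply: integral_ae_eq => //.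
    + exact: Radon_Nikodym_SigmaFinite.f_integrable.
    + exact/measurable_EFinP.
    + by move=> B _ mB; rewrite -Radon_Nikodym_SigmaFinite.f_integral//= fE.
  by apply: filterS => x /(_ I) /= ->.
Qed.

Lemma measurable_pos f : measurable_fun setT f ->
  measurable [set x | 0 < f x].
Proof.
move=> mf; rewrite -[X in measurable X]setTI.
apply: (@measurable_fun_ltr _ _ _ setT (cst 0) f) => //; exact: measurable_cst.
Qed.

(** The [nu]-mass of the set where [f] vanishes is an integral of 0. Hence the logarithm of a
    density is finite almost everywhere for the measure it defines. *)
Lemma is_density_gt0 m nu f : is_density m nu f -> {ae nu, forall x, 0 < f x}.
Proof.
move=> [mf f0 fE]; exists (~` [set x | 0 < f x]); split => //.
  exact/measurableC/measurable_pos.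
rewrite fE; last exact/measurableC/measurable_pos.
by apply: integral0_eq => x /negP; rewrite -leNgt => fx0; apply/eqP;
  rewrite eqe eq_le fx0 f0.
Qed.

Lemma measurable_div_ge0 f g : measurable_fun setT f -> measurable_fun setT g ->
  (forall x, 0 <= g x) -> measurable_fun setT (fun x => f x / g x).
Proof.
move=> mf mg g0; apply: measurable_funM => //.
rewrite (_ : (fun x => _) = (@powR R ^~ (-1)) \o g).
  exact: measurableT_comp (@measurable_powR R (-1)) mg.
by apply/funext => x /=; rewrite powR_inv1.
Qed.

(* Division by 0 gives the value 0 where [g] vanishes; there [f] vanishes almost
   everywhere since [nu] is dominated by [pi]. *)
Lemma is_density_div m nu pi f g : is_density m nu f -> is_density m pi g ->
  nu `<< pi -> is_density pi nu (fun x => f x / g x).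
Proof.
move=> df dg nupi; have [mf f0 fE] := df; have [mg g0 gE] := dg.
have mfg : measurable_fun setT (fun x => f x / g x).
  exact: measurable_div_ge0.
split=> //; first by move=> x; rewrite divr_ge0.
move=> A mA; rewrite (ge0_integral_density dg)//; last 2 first.
- exact/measurable_EFinP.
- by move=> x; rewrite lee_fin divr_ge0.
have mG := measurable_pos mg.
have fg0 : ae_eq m (~` [set x | 0 < g x]) (EFin \o f) (cst 0%E).
  apply/ae_eq_integral_abs; first exact: measurableC.
    by apply/measurable_EFinP; exact: measurable_funTS.
  under eq_integral => x _ do rewrite /= ger0_norm//.
  rewrite -fE; last exact: measurableC.
  have /null_content_dominatesP := nupi; apply; first exact: measurableC.
  apply/measure_negligible; first exact: measurableC.
  exact: is_density_gt0 dg.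
rewrite fE//; apply: ge0_ae_eq_integral => //.
- by apply/measurable_EFinP; exact: measurable_funTS.
- apply: measurable_funTS; apply/measurable_EFinP.
  exact: measurable_funM.
- by move=> x _; rewrite lee_fin.
- by move=> x _; rewrite lee_fin mulr_ge0// divr_ge0.
- apply: filterS fg0 => x fg0 _; have [gx|gx] := ltP 0 (g x).
    by rewrite -EFinM divfK// gt_eqF.
  have -> : g x = 0 by apply/eqP; rewrite eq_le gx g0.
  by rewrite mule0; apply: fg0; apply/negP; rewrite -leNgt.
Qed.

(** * Kullback-Leibler divergence and powers of a density *)

Lemma lne_EFinE (x : R) : lne x%:E = if 0 < x then (ln x)%:E else -oo%E.
Proof. by rewrite /= ltNge; case: leP. Qed.

Lemma measurable_lne_EFin f : measurable_fun setT f ->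
  measurable_fun setT (fun x => lne (f x)%:E).
Proof.
move=> mf; under eq_fun do rewrite lne_EFinE.
apply: measurable_fun_ifT.
- by apply: measurable_fun_ltr => //; exact: measurable_cst.
- by apply/measurable_EFinP; exact: measurableT_comp (@measurable_ln R) mf.
- exact: measurable_cst.
Qed.

(** The Radon-Nikodym derivative and [f] agree [pi]-almost everywhere, hence [nu]-almost everywhere
    by domination. *)
Lemma KL_density nu pi f : is_density pi nu f ->
  KL nu pi = (\int[nu]_x lne (f x)%:E)%E.
Proof.
move=> df; have [mf f0 fE] := df; have nupi := is_density_dominates df.
rewrite /KL asboolT//.
set r := Radon_Nikodym _ _.
have mr : measurable_fun setT r.
  by apply: measurable_int; exact: Radon_Nikodym_integrable.
have rfin x : r x = (fine (r x))%:E.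
  by rewrite fineK//; exact: Radon_Nikodym_fin_num.
have rf : ae_eq pi setT r (EFin \o f).
  apply: integral_ae_eq => //.
  - exact: Radon_Nikodym_integrable.
  - exact/measurable_EFinP.
  - by move=> A _ mA; rewrite -Radon_Nikodym_integral//= -fE.
apply: ae_eq_integral => //.
- under eq_fun do rewrite rfin.
  by apply: measurable_lne_EFin; exact: measurableT_comp mr.
- exact: measurable_lne_EFin.
- have : ae_eq nu setT r (EFin \o f).
    exact: null_dominates_ae_eq rf.
  by apply: filterS => x /= /[apply] ->.
Qed.

(** The coefficient [b] may be negative, so linearity requires integrability, which the bound by 1
    supplies. *)
Lemma ge0_integral_affine nu f (a b : R) : measurable_fun setT f ->
  (forall x, 0 <= f x) -> (\int[nu]_x (f x)%:E <= 1)%E ->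
  (\int[nu]_x (a + b * f x)%:E = (a + b * fine (\int[nu]_x (f x)%:E))%:E)%E.
Proof.
move=> mf f0 f1.
have fi : nu.-integrable setT (EFin \o f).
  apply/integrableP; split; first exact/measurable_EFinP.
  under eq_integral => x _ do rewrite /= ger0_norm//.
  exact: le_lt_trans f1 (ltry _).
have ai : nu.-integrable setT (EFin \o cst a).
  exact: finite_measure_integrable_cst.
under eq_integral do rewrite EFinD EFinM.
rewrite integralD//; last exact: integrableZl fi.
rewrite integralZl// EFinD EFinM fineK//; last first.
  exact: (integrable_fin_num measurableT fi).
by rewrite integral_cst// -[X in _ = (X + _)%E]mule1 -(probability_setT nu).
Qed.

(** Under [pi] the integrand becomes [g / f * f], which is [g] where [f] is nonzero and 0 elsewhere.
    The inequality is strict when [nu2] charges the zeros of [f]. *)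
Lemma integral_ratio_le1 nu1 nu2 pi f g : is_density pi nu1 f ->
  is_density pi nu2 g -> (\int[nu1]_x (g x / f x)%:E <= 1)%E.
Proof.
move=> df dg; have [mf f0 fE] := df; have [mg g0 gE] := dg.
have mgf : measurable_fun setT (fun x => g x / f x).
  exact: measurable_div_ge0.
rewrite (ge0_integral_density df)//; last 2 first.
- exact/measurable_EFinP.
- by move=> x; rewrite lee_fin divr_ge0.
rewrite -(probability_setT nu2) gE//; apply: ge0_le_integral => //.
- by move=> x _; rewrite lee_fin mulr_ge0// divr_ge0.
- by apply/measurable_EFinP; exact: measurable_funM.
- exact/measurable_EFinP.
- move=> x _; rewrite -EFinM lee_fin; have [->|fx] := eqVneq (f x) 0.
    by rewrite mulr0.
  by rewrite divfK.
Qed.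

Lemma KL_powR_le nu1 nu2 pi f (s c : R) : 0 < s < 1 -> 0 < c ->
  is_density pi nu1 f -> is_density pi nu2 (fun x => c * f x `^ s) ->
  (KL nu2 pi <= KL nu1 pi)%E.
Proof.
move=> /andP[s0 s1] c0 df dg.
have [mf f0 fE] := df; have [mg g0 gE] := dg.
rewrite (KL_density df) (KL_density dg).
have s1' : 0 < 1 - s by rewrite subr_gt0.
have lnx (x : R) : 0 < x -> ln x <= x - 1.
  by move=> x0; rewrite -[x in ln x](subrKC 1) le_ln1Dx// ltrBrDl subrr.
have lng x : 0 < f x -> ln (c * f x `^ s) = ln c + s * ln (f x).
  by move=> fx; rewrite lnM ?posrE ?powR_gt0// ln_powR.
(* The intermediate value is a finite real, so no difference of possibly infinite divergences is
   ever formed. *)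
apply: (@le_trans _ _ (ln c / (1 - s))%:E).
- pose r x := f x / (c * f x `^ s).
  have mr : measurable_fun setT r.
    exact: measurable_div_ge0.
  have r0 x : 0 <= r x by rewrite divr_ge0.
  have r1 := integral_ratio_le1 dg df.
  (* With p = c f^s and r = f / p, one has (1 - s) ln p = ln c + s ln r <= ln c + s (r - 1), that
     is, ln p <= a + b r. As b > 0 and r has integral at most 1, the bound is a + b = ln c / (1 -
     s). *)
  pose a := (ln c - s) / (1 - s); pose b := s / (1 - s).
  apply: (@le_trans _ _ (\int[nu2]_x (a + b * r x)%:E)%E).
    apply: le_integral_ae => //.
    + exact: measurable_lne_EFin.
    + apply/measurable_EFinP; apply: measurable_funD => //.
      exact: measurable_funM.
    apply: filterS (is_density_gt0 dg) => x gx.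
    have fx : 0 < f x.
      rewrite lt_neqAle f0 eq_sym andbT; apply: contraTneq gx => ->.
      by rewrite powR0 ?gt_eqF// mulr0 ltxx.
    rewrite lne_EFinE gx lee_fin /a /b.
    rewrite mulrAC -mulrDl ler_pdivlMr//.
    have := lnx (r x) (divr_gt0 fx gx).
    rewrite ln_div ?posrE// lng// => H.
    have := ler_wpM2l (ltW s0) H. nra.
  rewrite ge0_integral_affine// lee_fin.
  have : fine (\int[nu2]_x (r x)%:E)%E <= 1.
    rewrite -[1]/(fine 1%E); apply: fine_le => //.
    by rewrite ge0_fin_numE ?(le_lt_trans r1) ?ltry//; apply: integral_ge0 => x _; rewrite lee_fin.
  rewrite /a /b mulrAC -mulrDl ler_pdivrMr// divfK ?gt_eqF//.
  set t := fine _ => t1; nra.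
- pose r x := c * f x `^ s / f x.
  have mr : measurable_fun setT r.
    exact: measurable_div_ge0.
  have r0 x : 0 <= r x by rewrite divr_ge0.
  have r1 := integral_ratio_le1 df dg.
  (* Now r = p / f gives (1 - s) ln f = ln c - ln r >= ln c + 1 - r, that is, ln f >= a + b r. Here
     b < 0, so the integral of r being at most 1 gives the lower bound a + b. *)
  pose a := (ln c + 1) / (1 - s); pose b := - (1 - s)^-1.
  apply: (@le_trans _ _ (\int[nu1]_x (a + b * r x)%:E)%E); last first.
    apply: le_integral_ae => //.
    + apply/measurable_EFinP; apply: measurable_funD => //.
      exact: measurable_funM.
    + exact: measurable_lne_EFin.
    apply: filterS (is_density_gt0 df) => x fx.
    have gx : 0 < c * f x `^ s by rewrite mulr_gt0// powR_gt0.
    rewrite lne_EFinE fx lee_fin /a /b.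
    rewrite mulNr mulrC -mulrBr mulrC ler_pdivrMr//.
    have := lnx (r x) (divr_gt0 gx fx).
    rewrite ln_div ?posrE// lng//. nra.
  rewrite ge0_integral_affine// lee_fin.
  have : fine (\int[nu1]_x (r x)%:E)%E <= 1.
    rewrite -[1]/(fine 1%E); apply: fine_le => //.
    by rewrite ge0_fin_numE ?(le_lt_trans r1) ?ltry//; apply: integral_ge0 => x _; rewrite lee_fin.
  rewrite /a /b mulNr [(1 - s)^-1 * _]mulrC -mulrBl ler_pdivlMr// divfK ?gt_eqF//.
  set t := fine _ => t1; lra.
Qed.

End density_lemmas.

(** * Normalized geometric mixtures of densities *)

Section geometric_mixtures.
Context {R : realType} {d : nat}.
Local Notation X := (Rd R d).
Local Notation leb := (lebesgueRd R d).
Implicit Types (rho mu pi : probability X R) (f g h : X -> R).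

Lemma has_density_eq mu mu' f : (forall A, measurable A -> mu A = mu' A) ->
  has_density mu f -> has_density mu' f.
Proof. by move=> mumu' [mf f0 fE]; split => // A mA; rewrite -mumu'// fE. Qed.

Lemma propto_ae rho h h' : measurable_fun setT h' -> (forall x, 0 <= h' x) ->
  {ae leb, forall x, h x = h' x} -> propto rho h -> propto rho h'.
Proof.
move=> mh' h'0 hh' [c c0 dh]; exists c => //.
apply: (is_density_ae dh).
- exact: measurable_funM.
- by move=> x; rewrite mulr_ge0// ltW.
- by apply: filterS hh' => x ->.
Qed.

(** The two measures differ by the factor [c / c'], and evaluating on the whole space, where both
    have mass 1, shows that this factor is 1. *)
Lemma propto_unique rho rho' h : propto rho h -> propto rho' h ->
  forall A, measurable A -> rho A = rho' A.
Proof.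
move=> [c c0 [mch ch0 chE]] [c' c'0 [mch' ch'0 ch'E]].
have E A : measurable A -> rho A = ((c / c')%:E * rho' A)%E.
  move=> mA; rewrite chE// ch'E// -ge0_integralZl_EFin//.
  - by apply: eq_integral => x _; rewrite -EFinM mulrA divfK// gt_eqF.
  - by move=> x _; rewrite lee_fin.
  - by apply/measurable_EFinP; exact: measurable_funTS.
  - by rewrite divr_ge0// ltW.
have cc' : c / c' = 1.
  apply: EFin_inj; rewrite -[RHS](probability_setT rho) E//.
  by rewrite -[LHS]mule1 -(probability_setT rho').
by move=> A mA; rewrite E// cc' mul1e.
Qed.

Lemma measurable_geometric f g (a b : R) : measurable_fun setT f ->
  measurable_fun setT g -> measurable_fun setT (fun x => f x `^ a * g x `^ b).
Proof.
move=> mf mg; apply: measurable_funM.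
- exact: measurableT_comp (@measurable_powR R a) mf.
- exact: measurableT_comp (@measurable_powR R b) mg.
Qed.

(** [propto_geometric] only provides some pair of densities; almost everywhere uniqueness allows any
    other pair to be substituted. *)
Lemma propto_geometricP rho mu pi f g (a b : R) : has_density mu f ->
  has_density pi g -> propto_geometric rho mu a pi b ->
  propto rho (fun x => f x `^ a * g x `^ b).
Proof.
move=> df dg [f' [g' [df' dg']]]; apply: propto_ae.
- by apply: measurable_geometric; [case: df|case: dg].
- by move=> x; rewrite mulr_ge0// powR_ge0.
- by apply: filterS2 (is_density_unique df' df) (is_density_unique dg' dg) => x -> ->.
Qed.

Lemma propto_geometric_unique rho rho' mu mu' pi (a b : R) :
  (forall A, measurable A -> mu A = mu' A) ->
  propto_geometric rho mu a pi b -> propto_geometric rho' mu' a pi b ->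
  forall A, measurable A -> rho A = rho' A.
Proof.
move=> mumu' [f [g [df dg rhofg]]] rho'fg.
apply: (propto_unique rhofg).
exact: propto_geometricP (has_density_eq mumu' df) dg rho'fg.
Qed.

(** This covers index 0 of the tempering sequence; where the density of [pi] vanishes it relies on
    the convention 0^0 = 1. *)
Lemma propto_geometric0 mu pi : (exists f, has_density mu f) ->
  (exists g, has_density pi g) -> propto_geometric mu mu (1 - 0) pi 0.
Proof.
move=> [f df] [g dg]; exists f, g; split => //; exists 1 => //.
rewrite (_ : (fun x => _) = f)//; apply/funext => x; have [_ f0 _] := df.
by rewrite subr0 powRr0 powRr1// mul1r mulr1.
Qed.

(** With t = (l' - l) / (1 - l), the exponents satisfy (1 - l)(1 - t) = 1 - l' and l (1 - t) + t =
    l', so (f^(1-l) g^l)^(1-t) g^t = f^(1-l') g^l'. *)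
Lemma propto_geometric_step rho rho' mu pi (l l' : R) :
  0 <= l -> l < l' -> l' <= 1 ->
  propto_geometric rho mu (1 - l) pi l ->
  propto_geometric rho' mu (1 - l') pi l' ->
  propto_geometric rho' rho (1 - (l' - l) / (1 - l)) pi ((l' - l) / (1 - l)).
Proof.
move=> l0 ll' l'1 [f [g [df dg [k k0 drho]]]] rho'fg.
have l1 : l < 1 := lt_le_trans ll' l'1.
have [c c0 drho'] := propto_geometricP df dg rho'fg.
have [_ f0 _] := df; have [_ g0 _] := dg.
exists (fun x => k * (f x `^ (1 - l) * g x `^ l)), g; split => //.
set t := (l' - l) / (1 - l).
have lt : l * (1 - t) + t = l' by rewrite /t; field; rewrite gt_eqF// subr_gt0.
have lt' : (1 - l) * (1 - t) = 1 - l'.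
  by rewrite /t; field; rewrite gt_eqF// subr_gt0.
(* The normalizing constant [k] of [rho] is raised to the power 1 - t along with its density, and is
   divided out here. *)
exists (c / k `^ (1 - t)); first by rewrite divr_gt0// powR_gt0.
rewrite (_ : (fun x => _) = (fun x => c * (f x `^ (1 - l') * g x `^ l')))//.
apply/funext => x.
(* Splitting the exponent is valid even where [g] vanishes, because the total exponent [l'] is
   positive. *)
have -> : g x `^ l' = g x `^ (l * (1 - t)) * g x `^ t.
  by rewrite -powRD ?lt// gt_eqF// (le_lt_trans l0).
rewrite !powRM ?mulr_ge0 ?powR_ge0// ?(ltW k0)// -!powRrM lt'.
rewrite !mulrA; congr (_ * _ * _ * _).
by rewrite divfK// gt_eqF// powR_gt0.
Qed.

Lemma KL_propto_geometric_le rho rho' pi (t : R) : 0 < t < 1 ->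
  propto_geometric rho' rho (1 - t) pi t -> (KL rho' pi <= KL rho pi)%E.
Proof.
move=> /andP[t0 t1] [f [g [df dg [c c0 dfg]]]].
have [rhopi|nrhopi] := pselect (rho `<< pi); last first.
  by rewrite [leRHS]/KL asboolF// leey.
have dq := is_density_div df dg rhopi; have [mq q0 _] := dq.
(* It remains to see that c (f / g)^(1-t) is a density of [rho'] with respect to [pi], which rests
   on (f / g)^(1-t) g = f^(1-t) g^t. *)
apply: (@KL_powR_le _ _ _ rho rho' pi _ (1 - t) c _ c0 dq).
  by rewrite subr_gt0 t1 gtrBl.
have mp : measurable_fun setT (fun x => c * (f x / g x) `^ (1 - t)).
  apply: measurable_funM => //.
  exact: measurableT_comp (@measurable_powR R (1 - t)) mq.
split => // [x|A mA]; first by rewrite mulr_ge0 ?powR_ge0// ltW.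
have [_ f0 _] := df; have [_ g0 _] := dg; have [_ _ ->] := dfg => //.
rewrite (ge0_integral_density dg)//; last 2 first.
- exact/measurable_EFinP.
- by move=> x; rewrite lee_fin mulr_ge0 ?powR_ge0// ltW.
apply: eq_integral => x _; rewrite -EFinM; congr EFin.
(* At a zero of [g] both sides vanish, the side containing g^t because t is nonzero. *)
have [->|gx] := eqVneq (g x) 0; first by rewrite powR0 ?gt_eqF// !mulr0.
have {1}-> : f x = f x / g x * g x by rewrite divfK.
rewrite powRM// -!mulrA -powRD ?gx ?implybT//.
by rewrite subrK powRr1.
Qed.

End geometric_mixtures.

(** * Step sizes and the comparison of the two sequences *)

Lemma tempering_step_size (R : realType) (lambda gamma : nat -> R) (n : nat) :
  lambda n != 1 ->
  lambda n = 1 - \prod_(1 <= k < n.+1) (1 - gamma k) ->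
  lambda n.+1 = 1 - \prod_(1 <= k < n.+2) (1 - gamma k) ->
  gamma n.+1 = (lambda n.+1 - lambda n) / (1 - lambda n).
Proof.
move=> ln1 lnE; rewrite big_nat_recr//= => ->.
set P := \prod_(_ <= _ < _) _ in lnE *.
(* The product is 1 - [lambda n], so the recurrence 1 - [lambda n.+1] = P (1 - [gamma n.+1]) can be
   solved for the step size. *)
have P0 : P != 0 by apply: contraNneq ln1 => P0; rewrite lnE P0 subr0.
by rewrite lnE subKr; field.
Qed.

Unset Implicit Arguments.

Theorem mainTheorem2 (R : realType) (d : nat)
    (mu0 pi : probability (Rd R d) R)
    (mu0_density : exists f, has_density mu0 f)
    (pi_density : exists g, has_density pi g)
    (T : nat) (T_ge1 : (1 <= T)%N)
    (lambda : nat -> R)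
    (lambda_0 : lambda 0%N = 0)
    (lambda_lt : forall n, (n < T)%N -> lambda n < lambda n.+1)
    (lambda_T : lambda T = 1)
    (mu : nat -> probability (Rd R d) R)
    (mu_tempering : tempering_sequence T lambda mu0 pi mu) :
  (forall (gamma : nat -> R) (nu : nat -> probability (Rd R d) R),
    mirror_descent_sequence T gamma mu0 pi nu ->
    (forall n, (1 <= n <= T)%N ->
      lambda n = 1 - \prod_(1 <= k < n.+1) (1 - gamma k)) ->
    [/\ forall n, (1 <= n <= T)%N ->
          forall A, measurable A -> nu n A = mu n A,
        gamma 1%N = lambda 1%N,
        forall n, (1 <= n < T)%N ->
          gamma n = (lambda n - lambda n.-1) / (1 - lambda n.-1) &
        gamma T = lambda T /\ lambda T = 1]) /\
  (forall gamma : nat -> R,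
    (forall n, (1 <= n <= T)%N ->
      gamma n = (lambda n - lambda n.-1) / (1 - lambda n.-1)) ->
    forall n, (1 <= n <= T)%N -> 0 < lambda n < 1 ->
      gamma n < 1 /\ (KL (mu n) pi <= KL (mu n.-1) pi)%E).
Proof.
have lambda_mono m n : (m <= n)%N -> (n <= T)%N -> lambda m <= lambda n.
  elim: n => [|n IHn]; first by rewrite leqn0 => /eqP ->.
  rewrite leq_eqVlt => /predU1P[-> //|mn] nT.
  exact: le_trans (IHn mn (ltnW nT)) (ltW (lambda_lt _ nT)).
have lambda_ge0 n : (n <= T)%N -> 0 <= lambda n.
  by rewrite -lambda_0; exact: lambda_mono.
have lambda_le1 n : (n <= T)%N -> lambda n <= 1.
  by move=> nT; rewrite -lambda_T; exact: lambda_mono.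
have lambda_lt1 n : (n < T)%N -> lambda n < 1.
  by move=> nT; exact: lt_le_trans (lambda_lt _ nT) (lambda_le1 _ nT).
have [mu_0 mu_n] := mu_tempering.
have mu_geom n : (n <= T)%N ->
    propto_geometric (mu n) mu0 (1 - lambda n) pi (lambda n).
  case: n => [_|n nT]; last exact: mu_n.
  by rewrite mu_0 lambda_0; exact: propto_geometric0.
have mu_step n : (n < T)%N -> propto_geometric (mu n.+1) (mu n)
    (1 - (lambda n.+1 - lambda n) / (1 - lambda n)) pi
    ((lambda n.+1 - lambda n) / (1 - lambda n)).
  move=> nT; apply: propto_geometric_step (mu_geom _ (ltnW nT)) (mu_geom _ nT).
  - exact/lambda_ge0/ltnW.
  - exact: lambda_lt.
  - exact: lambda_le1.
split=> [gamma nu [nu_0 nu_n] lambdaE|gamma gammaE [//|n] /= nT /andP[l0 l1]].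
  have gammaE n : (n < T)%N ->
      gamma n.+1 = (lambda n.+1 - lambda n) / (1 - lambda n).
    move=> nT; apply: tempering_step_size; last exact: lambdaE.
      by rewrite lt_eqF// lambda_lt1.
    (* The assumed product formula starts at index 1; at index 0 it holds because the product is
       empty and [lambda 0] is 0. *)
    case: n nT => [_|n nT]; first by rewrite big_geq// lambda_0 subrr.
    by apply: lambdaE; exact: ltnW.
  split.
  (* The induction starts at index 0, where both sequences equal [mu0]. *)
  - suff nu_mu n : (n <= T)%N -> forall A, measurable A -> nu n A = mu n A.
      by move=> n /andP[_ nT]; exact: nu_mu.
    elim: n => [_ A _|n IHn nT]; first by rewrite nu_0 mu_0.
    apply: propto_geometric_unique (IHn (ltnW nT)) (nu_n _ nT) _.
    by rewrite gammaE//; exact: mu_step.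
  - by rewrite gammaE// lambda_0 !subr0 divr1.
  - by case=> [//|n] nT; rewrite gammaE// ltnW.
  (* For the last step the numerator and denominator are both 1 - [lambda T.-1], which is
     nonzero. *)
  - have T1 : (T.-1 < T)%N by rewrite prednK.
    split=> //; move: (gammaE _ T1); rewrite prednK// lambda_T divff//.
    by rewrite subr_eq0 gt_eqF// lambda_lt1.
have g0 : 0 < gamma n.+1.
  by rewrite gammaE// divr_gt0// subr_gt0; [exact: lambda_lt|exact: lambda_lt1].
(* The numerator is smaller than the denominator exactly because [lambda n.+1] < 1. *)
have g1 : gamma n.+1 < 1.
  rewrite gammaE// ltr_pdivrMr ?subr_gt0 ?lambda_lt1// mul1r.
  by rewrite ltrD2r.
split=> //; apply: (@KL_propto_geometric_le _ _ _ _ _ (gamma n.+1)).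
  by rewrite g0.
by rewrite gammaE//; exact: mu_step.
Qed.
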